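(* Let $G$ be a finite connected simple graph with $n$ vertices and $m$ edges, and let $k\ge 1$ be an integer. Then \[\Pi_1(R_k(G))=4^{km}(k+1)^{2n}\,\Pi_1(G).\]
   Context: For a graph $H$ and vertex $v$, $d_H(v)$ denotes the degree of $v$ in $H$. Define $\Pi_1(H)=\prod_{v\in V(H)} d_H(v)^2$. The $k$-th semi total point graph $R_k(G)$ is obtained from $G$ by adding, for each edge $uv$ of $G$, $k$ new vertices (distinct for distinct edges) and joining each of them to both $u$ and $v$ (the edges of $G$ are kept). *)

(* Defs.v *)
From mathcomp Require Import all_boot.

Set Implicit Arguments.
Unset Strict Implicit.
Unset Printing Implicit Defensive.

Record sgraph := SGraph {
  vertex :> finType;
  adj : rel vertex;
  adj_sym : symmetric adj;
  adj_irr : irreflexive adj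
}.

Definition edges (G : sgraph) : {set {set G}} :=
  [set e | [exists u : G, exists v : G, adj u v && (e == [set u; v])]].

(* The graph without vertices is not considered connected. *)
Definition connected (G : sgraph) : Prop :=
  0 < #|G| /\ forall u v : G, connect (@adj G) u v.

Definition degree (G : sgraph) (v : G) : nat := #|[set w : G | adj v w]|.

Definition Pi1 (G : sgraph) : nat := \prod_(v : G) degree v ^ 2.

Section SemiTotalPointGraph.

Variables (k : nat) (G : sgraph).

(* [inl v] is an original vertex; [inr (e, i)] is the i-th of the k new
   vertices attached to the edge e. *)
Definition Rk_vertex : finType := (G + {e : {set G} | e \in edges G} * 'I_k)%type.

Definition Rk_adj : rel Rk_vertex := fun x y =>
  match x, y with
  | inl u, inl v => adj u v
  | inl u, inr (e, _) => u \in val e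
  | inr (e, _), inl v => v \in val e
  | inr _, inr _ => false
  end.

Lemma Rk_adj_sym : symmetric Rk_adj.
Proof. by move=> [u|[e i]] [v|[f j]] //=; apply: adj_sym. Qed.

Lemma Rk_adj_irr : irreflexive Rk_adj.
Proof. by move=> [u|[e i]] //=; apply: adj_irr. Qed.

Definition Rk : sgraph := SGraph Rk_adj_sym Rk_adj_irr.

End SemiTotalPointGraph.

(* Main.v *)
Require Import Defs.
From mathcomp Require Import all_boot.

(** An original vertex of degree d keeps its d neighbours and gains k new ones for each of its d
    incident edges, so its degree becomes (k+1)d ([degree_Rk_old]); a new vertex sees exactly the
    two ends of its edge ([degree_Rk_new]). Squaring and multiplying, the n original vertices give
    (k+1)^(2n) times [Pi1 G], and each of the km new ones gives 4. *)

Lemma degreeE (G : sgraph) (v : G) : degree v = \sum_(w : G) adj v w.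
Proof. by rewrite /degree -sum1dep_card big_mkcond; apply: eq_bigr => w; case: adj. Qed.

Lemma card_edge (G : sgraph) (e : {set G}) : e \in edges G -> #|e| = 2.
Proof.
rewrite inE => /existsP[u /existsP[v /andP[uv /eqP->]]].
by rewrite cards2; case: eqVneq uv => // ->; rewrite adj_irr.
Qed.

(** The map w -> {u, w} is a bijection from the neighbours of u onto the edges through u. *)
Lemma card_incident_edges (G : sgraph) (u : G) :
  #|[set e in edges G | u \in e]| = degree u.
Proof.
rewrite /degree -(card_in_imset (f := fun w => [set u; w])); last first.
  (* Injectivity: v lies in {u, w}, and v = u would make u adjacent to itself. *)
  move=> v w; rewrite !inE => uv uw /setP/(_ v); rewrite !inE eqxx orbT.
  by case: eqVneq uv => [->|_ _ /esym/eqP]; rewrite ?adj_irr.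
apply: eq_card => e; rewrite !inE; apply/andP/imsetP.
  case=> /existsP[x /existsP[y /andP[xy /eqP->]]].
  rewrite !inE => /orP[]/eqP->; first by exists y; rewrite ?inE.
  by exists x; rewrite ?inE 1?adj_sym // setUC.
case=> v; rewrite inE => uv ->; rewrite !inE eqxx; split=> //.
by apply/existsP; exists u; apply/existsP; exists v; rewrite uv eqxx.
Qed.

(** Recasts the incidence count over the subtype of edges that indexes the new vertices of [Rk]. *)
Lemma sum_incident_edges (G : sgraph) (u : G) :
  \sum_(e : {e : {set G} | e \in edges G}) (u \in val e) = degree u.
Proof.
rewrite -card_incident_edges -sum1dep_card big_mkcondr [RHS]big_sub.
by apply: eq_bigr => e _; case: (u \in _).
Qed.

Lemma sum_pair_fst (I : finType) (k : nat) (F : I -> nat) :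
  \sum_(p : I * 'I_k) F p.1 = k * \sum_i F i.
Proof.
rewrite -(pair_bigA _ (fun i (_ : 'I_k) => F i)) /= big_distrr /=.
by apply: eq_bigr => i _; rewrite sum_nat_const card_ord.
Qed.

Lemma degree_Rk_old (k : nat) (G : sgraph) (u : G) :
  degree (inl u : Rk k G) = (k + 1) * degree u.
Proof.
(* Original neighbours account for the summand [1 * degree u]; the new ones must give
   [k * degree u]. *)
rewrite degreeE big_sumType addnC mulnDl mul1n -(degreeE G); congr (_ + _).
rewrite -sum_incident_edges -sum_pair_fst.
by apply: eq_bigr => -[e i].
Qed.

Lemma degree_Rk_new (k : nat) (G : sgraph) (p : {e : {set G} | e \in edges G} * 'I_k) :
  degree (inr p : Rk k G) = 2.
Proof.
(* New vertices are pairwise nonadjacent, so only the members of [e] count. *)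
case: p => e i; rewrite degreeE big_sumType /= [X in _ + X]big1 // addn0.
rewrite -(card_edge _ _ (valP e)) -sum1_card [RHS]big_mkcond.
by apply: eq_bigr => v _; case: (v \in _).
Qed.

Theorem theorem2p11 (G : sgraph) (n m k : nat)
    (hconn : connected G) (hn : #|G| = n) (hm : #|edges G| = m) (hk : 1 <= k) :
  Pi1 (Rk k G) = 4 ^ (k * m) * (k + 1) ^ (2 * n) * Pi1 G.
Proof.
rewrite /Pi1 big_sumType /=.
under eq_bigr do rewrite degree_Rk_old expnMn.
under [X in _ * X]eq_bigr do rewrite degree_Rk_new.
rewrite big_split /= !prod_nat_const card_prod card_ord card_sig.
(* The new vertices contribute [(2 ^ 2) ^ (k * m)], which is [4 ^ (k * m)] by computation. *)
by rewrite hn hm -expnM (mulnC m) mulnC mulnA.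
Qed.
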